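(* Let $\Gamma$ be a simplicial complex with no isolated vertices, with vertex set bipartitioned into sets $\mathfrak{L}$ and $\mathfrak{R}$. Then the $\Gamma$-ruleset $R_\Gamma$ is invariant.
   Context: Games. A board is a finite graph. A ruleset $R$ specifies which pieces each of the two players, Left and Right, may place (each piece occupies a non-empty collection of vertices of the board, a piece being thought of as a subgraph of the board) and which placements are legal. Pieces are placed on empty spaces of an initially empty board and are never moved or removed. A position is a configuration of pieces on the board. A basic position is the board with exactly one piece placed. A position is legal if it can be reached from the empty board by a sequence of legal moves, and illegal otherwise. In a strong placement game (SP-game), if a position can be reached through legal moves then any sequence of moves leading to it consists of legal moves. A board isomorphism between two boards (possibly already containing pieces) is a graph isomorphism such that a vertex contains a Left (respectively Right) piece if and only if its image does. The ruleset of an SP-game is invariant if: every basic position is legal; and the ruleset does not depend on the board, i.e. for any board isomorphism between boards $B_1$ and $B_2$, a move in $B_1$ is legal if and only if its isomorphic image in $B_2$ is legal. An isolated vertex of a simplicial complex is a vertex $v$ such that $\{v\}$ is a facet. The edges of $\Gamma$ are its $1$-dimensional faces. $\Gamma$-ruleset $R_\Gamma$. If $\Gamma$ is empty, Left and Right place pieces on a single vertex with no restrictions. Otherwise let $n$ be the number of vertices of $\Gamma$ and label its edges $1,\dots,k$. Left's pieces are cycles of length $n^4+4$ with a cycle of length $n^3$ attached at each of $n-1$ consecutive vertices; Right's pieces are cycles of length $n^4+5$ with a cycle of length $n^3$ attached at each of $n-1$ consecutive vertices. For each facet $F$ of $\Gamma$ with $f$ vertices, whose edges are labelled $k_1,\dots,k_l$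 with $l=\binom{f}{2}$, the id-set of $F$ is $\{k_1+1,\dots,k_l+1\}$; it is forbidden to have a set of $f$ pieces such that the set of distances between any two of these pieces is exactly the id-set of $F$. Here the distance between two pieces occupying vertex sets $V_1,V_2$ is $\min\{d(v_1,v_2): v_1\in V_1, v_2\in V_2\}$, where $d$ is graph distance in the board.
   Formalization: A board isomorphism is additionally required to carry the pieces already placed on the first board to those on the second; matching only the vertices containing Left or Right pieces makes the claim false, since different pieces can occupy the same vertices. *)

(* Defs.v *)
From HB Require Import structures.
From mathcomp Require Import all_boot.

Set Implicit Arguments.
Unset Strict Implicit.
Unset Printing Implicit Defensive.

(** * Boards, pieces and positions *)

Record board := Board {
  space :> finType;
  adj : rel space;
  adj_sym : symmetric adj;
  adj_irr : irreflexive adj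
}.
Arguments adj {b} _ _.

Inductive player := Left | Right.

Definition bool_of_player (P : player) : bool := if P is Left then true else false.
Definition player_of_bool (b : bool) : player := if b then Left else Right.
Lemma bool_of_playerK : cancel bool_of_player player_of_bool.
Proof. by case. Qed.
HB.instance Definition _ := Finite.copy player (can_type bool_of_playerK).

(* A vertex set and a set of edges; each edge is listed in both directions. *)
Definition subg (B : board) : Type := ({set B} * {set B * B})%type.

Definition is_subgraph (B : board) (H : subg B) : Prop :=
  forall u v, (u, v) \in H.2 ->
    [/\ adj u v, u \in H.1, v \in H.1 & (v, u) \in H.2].

Definition placement (B : board) : Type := (player * subg B)%type.
Definition owner (B : board) (x : placement B) : player := x.1.
Definition verts (B : board) (x : placement B) : {set B} := x.2.1.

Definition position (B : board) : Type := {set placement B}.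

Definition contains (B : board) (p : position B) (P : player) (v : B) : bool :=
  [exists x in p, (owner x == P) && (v \in verts x)].

(** * Rulesets *)

(* [may_place] gives the pieces of each player, [permits p x] says that the
   ruleset does not forbid placing [x] when the position is [p]. *)
Record ruleset := Ruleset {
  may_place : forall B : board, player -> subg B -> Prop;
  permits : forall B : board, position B -> placement B -> Prop
}.

Section Play.
Variables (R : ruleset) (B : board).
Implicit Types (p q : position B) (x y : placement B) (s : seq (placement B)).

Definition is_piece x : Prop :=
  [/\ verts x != set0, is_subgraph x.2 & may_place R (owner x) x.2].

Definition configuration p : Prop :=
  (forall x, x \in p -> is_piece x) /\
  {in p &, forall x y, x != y -> [disjoint verts x & verts y]}.

(* Pieces go on empty spaces only, whether or not the ruleset permits them. *)
Definition move p x : Prop :=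
  is_piece x /\ {in p, forall y, [disjoint verts y & verts x]}.

Definition legal_move p x : Prop := move p x /\ permits R p x.

(* Placing the pieces of [s] in order leads from [p] to [q], and every step
   satisfies [step]. *)
Fixpoint play (step : position B -> placement B -> Prop) p s q : Prop :=
  if s is x :: s' then step p x /\ play step (x |: p) s' q else p = q.

Definition legal_position p : Prop := exists s, play legal_move set0 s p.

End Play.

Definition strong_placement (R : ruleset) : Prop :=
  forall (B : board) (p : position B), legal_position R p ->
    forall s, play (move R (B := B)) set0 s p -> play (legal_move R (B := B)) set0 s p.

Record sp_ruleset := SPRuleset {
  rules :> ruleset;
  rules_strong : strong_placement rules
}.

Section Strong.
Variables (R : ruleset) (ok : forall B : board, position B -> Prop).
Hypothesis ok_sub : forall (B : board) (p q : position B), p \subset q -> ok q -> ok p.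
Hypothesis permitsE :
  forall (B : board) (p : position B) x, permits R p x <-> ok (x |: p).

Lemma play_sub (B : board) step (s : seq (placement B)) p q :
  play step p s q -> p \subset q.
Proof.
elim: s p => [|x s IH] p /= => [-> //|[_ /IH]].
by apply: subset_trans; apply: subsetUr.
Qed.

Lemma play_ok (B : board) (s : seq (placement B)) p q :
  play (legal_move R (B := B)) p s q -> s = [::] \/ ok q.
Proof.
elim: s p => [|x s IH] p /=; first by left.
case=> [[_ /permitsE okx] pl]; right.
by case: (IH _ pl) => // s0; rewrite s0 /= in pl; rewrite -pl.
Qed.

Lemma hereditary_strong : strong_placement R.
Proof.
move=> B p [s pl] s'; case: (play_ok pl) => [s0|okp {s pl}].
  rewrite s0 /= in pl; rewrite -pl; case: s' => //= x s' [_ /play_sub].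
  by move/subsetP/(_ x); rewrite !inE eqxx => /(_ isT).
elim: s' (set0 : position B) => [|x s' IH] q //= [mx pl]; split; last exact: IH.
split=> //; apply/permitsE; exact: ok_sub (play_sub pl) okp.
Qed.

End Strong.

(** * Board isomorphisms and invariance *)

Definition map_placement (B1 B2 : board) (phi : B1 -> B2) (x : placement B1) :
    placement B2 :=
  (owner x, (phi @: verts x, [set (phi e.1, phi e.2) | e in x.2.2])).

(* Matching the owners of the occupied vertices alone would also identify two
   positions that group the same vertices into different pieces, although the
   legality of a move can depend on the pieces; hence the last clause. *)
Definition board_iso (B1 B2 : board) (p1 : position B1) (p2 : position B2)
    (phi : B1 -> B2) : Prop :=
  [/\ bijective phi,
      {mono phi : u v / adj u v},
      forall P v, contains p1 P v = contains p2 P (phi v) &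
      forall x, (x \in p1) = (map_placement phi x \in p2)].

Definition invariant_ruleset (R : sp_ruleset) : Prop :=
  (forall (B : board) (x : placement B),
     is_piece R x -> legal_position R [set x]) /\
  (forall (B1 B2 : board) (p1 : position B1) (p2 : position B2) (phi : B1 -> B2),
     configuration R p1 -> configuration R p2 -> board_iso p1 p2 phi ->
     forall x : placement B1,
       legal_move R p1 x <-> legal_move R p2 (map_placement phi x)).

(** * Distances *)

(* The least [d < N] with [a d], if any. *)
Definition least (N : nat) (a : pred nat) : option nat :=
  ohead [seq d <- iota 0 N | a d].

Definition walk (B : board) (u v : B) (d : nat) : bool :=
  [exists s : d.-tuple B, path adj u s && (last u s == v)].

(* Finite distances are smaller than the number of vertices; [None] stands for
   an infinite distance. *)
Definition gdist (B : board) (u v : B) : option nat := least #|B| (walk u v).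

Definition piece_dist (B : board) (x y : placement B) : option nat :=
  least #|B| (fun d =>
    [exists u in verts x, exists v in verts y, gdist u v == Some d]).

Definition distances (B : board) (Q : {set placement B}) : seq (option nat) :=
  [seq piece_dist z.1 z.2 | z in [set z in setX Q Q | z.1 != z.2]].

(** * Simplicial complexes *)

Section Complex.
Variables (V : finType) (Gamma : {set {set V}}).

Definition simplicial_complex : Prop :=
  forall F G : {set V}, F \in Gamma -> G \subset F -> G \in Gamma.

Definition vertices : {set V} := [set v | [set v] \in Gamma].

Definition edges : {set {set V}} := [set e in Gamma | #|e| == 2].

Definition facet (F : {set V}) : bool := maxset (fun A => A \in Gamma) F.

Definition isolated (v : V) : bool := facet [set v].

Definition edge_labelling (lab : {set V} -> nat) : Prop :=
  perm_eq [seq lab e | e in edges] (iota 1 #|edges|).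

Definition id_set (lab : {set V} -> nat) (F : {set V}) : seq nat :=
  [seq (lab e).+1 | e in [set e in edges | e \subset F]].

End Complex.

(** * The ruleset of a simplicial complex *)

Definition cyc (m a b : nat) : bool := (b == a.+1 %% m) || (a == b.+1 %% m).

(* A cycle of length [m] with a cycle of length [c] glued at each of its
   vertices [0, ..., k - 1].  Vertex [0] of the [j]-th attached cycle is
   [inl j]; its vertex [t.+1] is [inr (j, t)]. *)
Definition shape (m k c : nat) : finType := ('I_m + 'I_k * 'I_c.-1)%type.

Definition shape_adj (m k c : nat) : rel (shape m k c) := fun a b =>
  match a, b with
  | inl i, inl i' => cyc m i i'
  | inl i, inr (j, t) | inr (j, t), inl i => (val i == val j) && cyc c 0 t.+1
  | inr (j, t), inr (j', t') => (j == j') && cyc c t.+1 t'.+1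
  end.

Definition is_copy (B : board) (T : finType) (e : rel T) (H : subg B) : Prop :=
  exists f : T -> B,
    [/\ injective f,
        H.1 = [set f a | a in T] &
        H.2 = [set (f z.1, f z.2) | z in [set z : T * T | e z.1 z.2]]].

Section GammaRuleset.
Variables (V : finType) (Gamma : {set {set V}}) (lab : {set V} -> nat).

Definition forbidden (B : board) (F : {set V}) (Q : {set placement B}) : Prop :=
  #|Q| = #|F| /\ distances Q =i [seq Some d | d <- id_set Gamma lab F].

(* Both the void complex and the complex whose only face is empty count as
   empty. *)
Definition Gamma_rules : ruleset :=
  let n := #|vertices Gamma| in
  if n == 0 then
    {| may_place := fun B _ => is_copy (fun _ _ : unit => false);
       permits := fun B _ _ => True |}
  else
    {| may_place := fun B P =>
         is_copy (@shape_adj (n ^ 4 + if P is Left then 4 else 5) n.-1 (n ^ 3));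
       permits := fun B p x =>
         forall F, facet Gamma F ->
         forall Q : {set placement B}, Q \subset x |: p -> ~ forbidden F Q |}.

Lemma Gamma_strong : strong_placement Gamma_rules.
Proof.
rewrite /Gamma_rules; case: ifP => _.
  by apply: (@hereditary_strong _ (fun _ _ => True)).
apply: (@hereditary_strong _ (fun B p => forall F, facet Gamma F ->
  forall Q : {set placement B}, Q \subset p -> ~ forbidden F Q)) => // B p q spq okq.
by move=> F facF Q sQp; apply: okq facF _ (subset_trans sQp spq).
Qed.

Definition Gamma_ruleset : sp_ruleset := SPRuleset Gamma_strong.

End GammaRuleset.

(* Main.v *)
Require Import Defs.
From mathcomp Require Import all_boot.

(** A facet of a non-empty complex without isolated vertices has at least two
    vertices, so a single piece never completes a forbidden set.  A board
    isomorphism preserves walks of each length, hence the distances between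
    pieces, and carries copies of a graph to copies of it. *)

Set Implicit Arguments.
Unset Strict Implicit.
Unset Printing Implicit Defensive.

Lemma map_placementK (B1 B2 : board) (phi : B1 -> B2) (psi : B2 -> B1) :
  cancel phi psi -> cancel (map_placement phi) (map_placement psi).
Proof.
move=> phiK [P [A E]]; rewrite /map_placement /owner /verts /=.
congr (_, (_, _)).
  by rewrite -imset_comp -[RHS]imset_id; apply: eq_imset => v /=.
rewrite -imset_comp -[RHS]imset_id.
by apply: eq_imset => -[u v] /=; rewrite !phiK.
Qed.

(** This allows legality to be transferred in one direction only: the converse is the same result
    for [psi]. *)
Lemma board_iso_sym (B1 B2 : board) (p1 : position B1) (p2 : position B2)
    (phi : B1 -> B2) (psi : B2 -> B1) :
  cancel phi psi -> cancel psi phi ->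
  board_iso p1 p2 phi -> board_iso p2 p1 psi.
Proof.
move=> phiK psiK [_ adj_phi contains_phi mem_phi]; split.
- by exists phi.
- by move=> u v; rewrite -adj_phi !psiK.
- by move=> P v; rewrite contains_phi psiK.
- by move=> x; rewrite mem_phi (map_placementK psiK).
Qed.

Lemma least_eq (N : nat) (a b : pred nat) : a =1 b -> least N a = least N b.
Proof. by move=> eq_ab; rewrite /least (eq_filter eq_ab). Qed.

Lemma walk_map (B1 B2 : board) (phi : B1 -> B2) u v d :
  {mono phi : u v / adj u v} -> walk u v d -> walk (phi u) (phi v) d.
Proof.
move=> adj_phi /existsP[s /andP[pth /eqP <-]].
apply/existsP; exists (map_tuple phi s); rewrite /= last_map eqxx andbT path_map.
by rewrite (eq_path (e' := adj)) // => x y /=; apply: adj_phi.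
Qed.

(** The embedding [f] of the model graph is composed with [phi]. *)
Lemma is_copy_map (B1 B2 : board) (phi : B1 -> B2) (T : finType) (e : rel T)
    (H : subg B1) : injective phi -> is_copy e H ->
  is_copy e (phi @: H.1, [set (phi z.1, phi z.2) | z in H.2]).
Proof.
move=> phi_inj [f [f_inj -> ->]]; exists (phi \o f); split => /=.
- exact: inj_comp.
- by rewrite -imset_comp.
- by rewrite -imset_comp.
Qed.

Section BoardIsomorphism.
Variables (B1 B2 : board) (phi : B1 -> B2) (psi : B2 -> B1).
Hypotheses (phiK : cancel phi psi) (psiK : cancel psi phi).
Hypothesis adj_phi : {mono phi : u v / adj u v}.

Let phi_inj : injective phi := can_inj phiK.

(** [gdist] and [piece_dist] search below the number of vertices of the board, so these bounds must
    agree before the searches can be compared. *)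
Let card_eq : #|B1| = #|B2|.
Proof. by apply: bij_eq_card; exists psi; [apply: phiK|apply: psiK]. Qed.

Lemma walk_iso u v d : walk (phi u) (phi v) d = walk u v d.
Proof.
apply/idP/idP; last exact: walk_map.
(* A walk between the images is carried back by [psi], which preserves adjacency as well. *)
rewrite -{2}(phiK u) -{2}(phiK v); apply: walk_map => x y.
by rewrite -adj_phi !psiK.
Qed.

Lemma gdist_iso u v : gdist (phi u) (phi v) = gdist u v.
Proof. by rewrite /gdist card_eq; apply: least_eq => d; apply: walk_iso. Qed.

Lemma piece_dist_iso (x y : placement B1) :
  piece_dist (map_placement phi x) (map_placement phi y) = piece_dist x y.
Proof.
rewrite /piece_dist card_eq; apply: least_eq => d; apply/idP/idP.
  move=> /exists_inP[_ /imsetP[u xu ->]] /exists_inP[_ /imsetP[v yv ->]].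
  by rewrite gdist_iso => duv; apply/exists_inP; exists u => //;
    apply/exists_inP; exists v.
move=> /exists_inP[u xu] /exists_inP[v yv duv].
apply/exists_inP; exists (phi u); first exact: imset_f.
by apply/exists_inP; exists (phi v); rewrite ?gdist_iso //; apply: imset_f.
Qed.

Lemma distances_iso (Q : {set placement B1}) :
  distances (map_placement phi @: Q) =i distances Q.
Proof.
(* [distances] ranges over pairs of distinct pieces; injectivity makes two pieces distinct exactly
   when their images are. *)
have M_inj := can_inj (map_placementK phiK).
move=> d; apply/imageP/imageP.
  case=> -[x' y']; rewrite !inE /= => /andP[/andP[]].
  move=> /imsetP[x Qx ->] /imsetP[y Qy ->]; rewrite (inj_eq M_inj) => xy ->.
  by exists (x, y); rewrite ?inE /= ?Qx ?Qy //= piece_dist_iso.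
case=> -[x y]; rewrite !inE /= => /andP[/andP[Qx Qy] xy] ->.
exists (map_placement phi x, map_placement phi y); last first.
  by rewrite /= piece_dist_iso.
by rewrite !inE /= !imset_f //= (inj_eq M_inj).
Qed.

Lemma is_subgraph_iso (x : placement B1) :
  is_subgraph x.2 -> is_subgraph (map_placement phi x).2.
Proof.
move=> sub_x _ _ /imsetP[[u v] xuv [-> ->]] /=.
have [uv xu xv xvu] := sub_x _ _ xuv.
split; rewrite ?adj_phi ?imset_f //.
by apply/imsetP; exists (v, u).
Qed.

Lemma disjoint_verts_iso (x y : placement B1) :
  [disjoint verts x & verts y] ->
  [disjoint verts (map_placement phi x) & verts (map_placement phi y)].
Proof.
by move=> dxy; rewrite -setI_eq0 -imsetI ?imset_eq0 ?setI_eq0 //; apply: in2W.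
Qed.

Lemma move_iso (R : ruleset) (p1 : position B1) (p2 : position B2) x :
  (forall P (H : subg B1), may_place R P H ->
     may_place R P (phi @: H.1, [set (phi z.1, phi z.2) | z in H.2])) ->
  board_iso p1 p2 phi -> move R p1 x -> move R p2 (map_placement phi x).
Proof.
move=> place_iso [_ _ _ mem_phi] [[x0 sub_x place_x] disj_x]; split.
  split; [by rewrite imset_eq0 | exact: is_subgraph_iso | exact: place_iso].
(* Every piece of [p2] is the image of a piece of [p1], namely of its own image under [psi]. *)
move=> y p2y; rewrite -[y](map_placementK psiK).
by apply/disjoint_verts_iso/disj_x; rewrite mem_phi (map_placementK psiK).
Qed.

End BoardIsomorphism.

Section GammaRules.
Variables (V : finType) (Gamma : {set {set V}}) (lab : {set V} -> nat).

Lemma may_place_iso (B1 B2 : board) (phi : B1 -> B2) P (H : subg B1) :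
  injective phi -> may_place (Gamma_rules Gamma lab) P H ->
  may_place (Gamma_rules Gamma lab) P
    (phi @: H.1, [set (phi z.1, phi z.2) | z in H.2]).
Proof. by rewrite /Gamma_rules; case: ifP => _ /=; apply: is_copy_map. Qed.

Lemma Gamma_legal_move_iso (B1 B2 : board) (phi : B1 -> B2) (psi : B2 -> B1)
    (p1 : position B1) (p2 : position B2) (x : placement B1) :
  cancel phi psi -> cancel psi phi -> board_iso p1 p2 phi ->
  legal_move (Gamma_rules Gamma lab) p1 x ->
  legal_move (Gamma_rules Gamma lab) p2 (map_placement phi x).
Proof.
move=> phiK psiK iso [mv perm]; split.
  have [_ adj_phi _ _] := iso; apply: move_iso mv => // P H.
  exact/may_place_iso/(can_inj phiK).
move: perm; rewrite /Gamma_rules; case: ifP => _ //= perm F facF Q' sQ' [cQ' dQ'].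
have [_ adj_psi _ mem_psi] := board_iso_sym phiK psiK iso.
(* A forbidden set after the move on [B2] is pulled back along [psi] to one after the move on [B1],
   with the same number of pieces and the same distances. *)
apply: (perm F facF (map_placement psi @: Q')).
  apply/subsetP => _ /imsetP[y /(subsetP sQ') + ->]; rewrite !inE.
  case/orP => [/eqP-> | p2y]; first by rewrite (map_placementK phiK) eqxx.
  by rewrite -mem_psi p2y orbT.
split; first by rewrite card_imset //; apply/can_inj/(map_placementK psiK).
by move=> d; rewrite (distances_iso psiK phiK adj_psi) dQ'.
Qed.

(** A facet with one vertex would make that vertex isolated, and the empty face is not maximal
    because it lies in [[set v]] for any vertex [v] of the complex. *)
Lemma card_facet_gt1 (F : {set V}) :
  #|vertices Gamma| != 0 -> (forall v, ~~ isolated Gamma v) ->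
  facet Gamma F -> 1 < #|F|.
Proof.
rewrite -lt0n => /card_gt0P[v]; rewrite inE => Gv noiso facF.
rewrite ltnNge; apply/negP; rewrite leq_eqVlt ltnS leqn0.
case/orP => [/cards1P[w Fw] | /eqP/cards0_eq F0].
  by have := noiso w; rewrite /isolated -Fw facF.
have /maxsetP[_ /(_ [set v] Gv)] := facF.
by rewrite F0 sub0set => /(_ isT)/setP/(_ v); rewrite !inE eqxx.
Qed.

Lemma Gamma_basic_legal (B : board) (x : placement B) :
  (forall v, ~~ isolated Gamma v) -> is_piece (Gamma_rules Gamma lab) x ->
  legal_position (Gamma_rules Gamma lab) [set x].
Proof.
move=> noiso piece_x; exists [:: x]; split; last by rewrite /= setU0.
split; first by split=> // y; rewrite inE.
rewrite /Gamma_rules; case: ifPn => //= n0 F facF Q sQ [cQ _].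
(* A forbidden [Q] would have as many pieces as [F] has vertices, so at least two, but it lies in
   the singleton of [x]. *)
have := card_facet_gt1 n0 noiso facF; rewrite -cQ ltnNge.
by rewrite (leq_trans (subset_leq_card sQ)) // setU0 cards1.
Qed.

End GammaRules.

Unset Implicit Arguments.

Theorem lemma2p10 (V : finType) (Gamma : {set {set V}}) (L R : {set V})
    (lab : {set V} -> nat)
    (hGamma : simplicial_complex Gamma)
    (hisol : forall v : V, ~~ isolated Gamma v)
    (hLR : L :|: R = vertices Gamma) (hdisj : [disjoint L & R])
    (hlab : edge_labelling Gamma lab) :
  invariant_ruleset (Gamma_ruleset Gamma lab).
Proof.
split=> [B x | B1 B2 p1 p2 phi _ _ iso x]; first exact: Gamma_basic_legal.
have [[psi phiK psiK] _ _ _] := iso; split.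
  exact: Gamma_legal_move_iso psiK iso.
(* Writing [x] as the [psi]-image of its [phi]-image turns the converse into the forward direction
   for the inverse isomorphism. *)
rewrite -{2}[x](map_placementK phiK).
exact: Gamma_legal_move_iso phiK (board_iso_sym phiK psiK iso).
Qed.
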